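(* Let $(T,T')$ be a compatible pair of triangulations of the regular $(n+1)$-gon. If $(T,T')$ does not have a cone, then $\deg(\mathrm{NA}^{T,T'})=2$. Otherwise, $\deg(\mathrm{NA}^{T,T'})=3$.
   Context: Let $\Upsilon$ be the category whose objects are the sets $[n]=\{0,1,\dots,n\}$, $n\ge 0$, with arbitrary functions as morphisms. A symmetric set is a functor $X\colon \Upsilon^{\mathrm{op}}\to \mathsf{Set}$, with $X_n=X([n])$; it has an underlying simplicial set by restriction along $\Delta\to\Upsilon$. The Segal map sends $x\in X_n$ to the word of its principal edges (restrictions to $\{i-1,i\}$, $1\le i\le n$) in $X_1\times_{X_0}\cdots\times_{X_0}X_1$. $X$ is spiny if the Segal map is injective for all $n\ge1$. A partial groupoid is a spiny symmetric set. $\Upsilon^n=\hom_\Upsilon(-,[n])$ is the representable symmetric set. The spine $\mathrm{Sp}^n\subseteq\Upsilon^n$ consists of those functions $[m]\to[n]$ whose image lies in $\{i,i+1\}$ for some $i$. The vertices of the regular $(n+1)$-gon ($n\ge2$) are labelled $0,1,\dots,n$ in cyclic order. A triangulation $T$ (using only the vertices of the polygon) is regarded as the set of triples of vertices of its triangles (the order of the vertices of a triangle being immaterial). $H(T)\subseteq\Upsilon^n$ is the symmetric subset of those functions $[m]\to[n]$ whose image is contained in the vertex set of some triangle of $T$; it contains $\mathrm{Sp}^n$. The pair $T,T'$ is compatible if the pushout of symmetric sets $\mathrm{NA}^{T,T'}:=H(T)\amalg_{\mathrm{Sp}^n}H(T')$ is spiny. A cone from $T$ to $T'$ is a pair of triangles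 $(i-1,i,k)$ and $(i,i+1,k)$ in $T$ such that $(i-1,i,i+1)$ is a triangle in $T'$ (here $1\le i\le n-1$ and $k\in\{0,\dots,n\}\setminus\{i-1,i,i+1\}$). The compatible pair $(T,T')$ has a cone if there is a cone from $T$ to $T'$ or a cone from $T'$ to $T$. Degree: for $k\ge1$, call a subset of $[m]$ even of size $2k$ if it is a disjoint union of $k$ sets of the form $\{i,i+1\}$. A simplicial set $X$ is lower $(2k-1)$-Segal if for every $m\ge 2k$ the natural map $X_m\to\lim_{I}X_I$ is a bijection, where $I$ ranges over the poset of nonempty subsets of $[m]$ contained in some even subset of size $2k$, $X_I=X_{|I|-1}$ (via the order-preserving bijection $I\cong[|I|-1]$), and the maps are restrictions. The degree $\deg(X)$ of a symmetric set $X$ is the smallest $k\ge1$ such that the underlying simplicial set of $X$ is lower $(2k-1)$-Segal ($\infty$ if there is none). For example $\deg(X)=1$ if and only if $X$ is (the nerve of) a groupoid. *)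

(* Defs.v *)
From Stdlib Require Import Relation_Operators.
From mathcomp Require Import all_boot.
From mathcomp Require Import boolp.
From mathcomp Require Import zify.

Set Implicit Arguments.
Unset Strict Implicit.
Unset Printing Implicit Defensive.

Notation fun_ m n := {ffun 'I_m.+1 -> 'I_n.+1}.

Definition fid {n} : fun_ n n := [ffun i => i].
Definition fcomp {l m n} (f : fun_ m n) (g : fun_ l m) : fun_ l n :=
  [ffun i => f (g i)].

Lemma fcompA k l m n (f : fun_ m n) (g : fun_ l m) (h : fun_ k l) :
  fcomp (fcomp f g) h = fcomp f (fcomp g h).
Proof. by apply/ffunP => i; rewrite !ffunE. Qed.

Lemma fcompf1 m n (f : fun_ m n) : fcomp f fid = f.
Proof. by apply/ffunP => i; rewrite !ffunE. Qed.

Record symset := SymSet {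
  cell :> nat -> Type;
  res : forall {m n}, fun_ m n -> cell n -> cell m;
  res_id : forall n (x : cell n), res fid x = x;
  res_comp : forall l m n (f : fun_ m n) (g : fun_ l m) (x : cell n),
    res (fcomp f g) x = res g (res f x) }.

Record symmap (X Y : symset) := SymMap {
  app :> forall n, X n -> Y n;
  app_res : forall m n (f : fun_ m n) (x : X n),
    app (res f x) = res f (app x) }.

Definition edge {n} (i : 'I_n) : fun_ 1 n := [ffun j : 'I_2 => inord (i + j)].

(* The word of principal edges; its entries match on vertices automatically, so
   injectivity may be tested in the set of all words. *)
Definition segal_map (X : symset) n (x : X n) : n.-tuple (X 1) :=
  [tuple res (edge i) x | i < n].

Definition spiny (X : symset) : Prop :=
  forall n, 0 < n -> injective (@segal_map X n).

Definition representable (n : nat) : symset :=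
  @SymSet (fun m => fun_ m n) (fun l m f x => fcomp x f)
    (fun m x => fcompf1 x) (fun k l m f g x => esym (fcompA x f g)).

Section SubSymSet.
Variables (X : symset) (P : forall n, pred (X n)).
Hypothesis closed : forall m n (f : fun_ m n) (x : X n), P x -> P (res f x).

Definition sub_res m n (f : fun_ m n) (x : {x : X n | P x}) : {x : X m | P x} :=
  exist _ (res f (sval x)) (closed f (svalP x)).

Lemma sub_res_id n (x : {x : X n | P x}) : sub_res fid x = x.
Proof. by apply: val_inj; rewrite /= res_id. Qed.

Lemma sub_res_comp l m n (f : fun_ m n) (g : fun_ l m) (x : {x : X n | P x}) :
  sub_res (fcomp f g) x = sub_res g (sub_res f x).
Proof. by apply: val_inj; rewrite /= res_comp. Qed.

Definition sub_symset : symset := SymSet sub_res_id sub_res_comp.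
End SubSymSet.

Section Pushout.
Variables (S A B : symset) (u : symmap S A) (v : symmap S B).

Variant glue n : A n + B n -> A n + B n -> Prop :=
  Glue (s : S n) : glue (inl (u n s)) (inr (v n s)).

Definition glue_eqv n : A n + B n -> A n + B n -> Prop :=
  clos_refl_sym_trans _ (@glue n).

Definition po_cell n : Type :=
  {C : A n + B n -> Prop | exists x, C = glue_eqv x}.

Definition po_class n (x : A n + B n) : po_cell n :=
  exist _ (glue_eqv x) (ex_intro _ x erefl).

Definition sum_res m n (f : fun_ m n) (x : A n + B n) : A m + B m :=
  match x with inl a => inl (res f a) | inr b => inr (res f b) end.

Lemma glue_eqv_res m n (f : fun_ m n) x y :
  glue_eqv x y -> glue_eqv (sum_res f x) (sum_res f y).
Proof.
elim=> {x y} [_ _ [s] | x | x y _ h | x y z _ h1 _ h2] /=.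
- by apply: rst_step; rewrite -!app_res.
- exact: rst_refl.
- exact: rst_sym.
- exact: rst_trans h1 h2.
Qed.

Lemma glue_eqv_class n (x y : A n + B n) :
  glue_eqv x y -> glue_eqv x = glue_eqv y.
Proof.
move=> xy; apply: funext => z; apply: propext; split => h.
- exact: rst_trans (rst_sym _ _ _ _ xy) h.
- exact: rst_trans xy h.
Qed.

Lemma po_classP n (x y : A n + B n) :
  po_class x = po_class y <-> glue_eqv x y.
Proof.
split=> [[e] | h]; last by apply: eq_exist; apply: glue_eqv_class.
by rewrite e; apply: rst_refl.
Qed.

Lemma po_res_subproof m n (f : fun_ m n) (C : po_cell n) :
  exists x, (fun y => exists2 x, sval C x & glue_eqv (sum_res f x) y)
            = glue_eqv x.
Proof.
case: C => C [x e] /=; exists (sum_res f x); rewrite e.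
apply: funext => y; apply: propext; split=> [[z xz zy] | xy].
- exact: rst_trans (glue_eqv_res f xz) zy.
- by exists x => //; apply: rst_refl.
Qed.

(* The class of the restriction of any representative of [C]. *)
Definition po_res m n (f : fun_ m n) (C : po_cell n) : po_cell m :=
  exist _ _ (po_res_subproof f C).

Lemma po_res_class m n (f : fun_ m n) x :
  po_res f (po_class x) = po_class (sum_res f x).
Proof.
apply: eq_exist => /=; apply: funext => y; apply: propext.
split=> [[z xz zy] | xy].
- exact: rst_trans (glue_eqv_res f xz) zy.
- by exists x => //; apply: rst_refl.
Qed.

Lemma po_cell_class n (C : po_cell n) : exists x, C = po_class x.
Proof. by case: C => [C [x e]]; exists x; apply: eq_exist. Qed.

Lemma po_res_id n (C : po_cell n) : po_res fid C = C.
Proof.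
have [x ->] := po_cell_class C; rewrite po_res_class.
by case: x => x; rewrite /= res_id.
Qed.

Lemma po_res_comp l m n (f : fun_ m n) (g : fun_ l m) (C : po_cell n) :
  po_res (fcomp f g) C = po_res g (po_res f C).
Proof.
have [x ->] := po_cell_class C; rewrite !po_res_class.
by case: x => x; rewrite /= res_comp.
Qed.

Definition pushout : symset := SymSet po_res_id po_res_comp.

Definition po_inl : symmap A pushout :=
  @SymMap A pushout (fun n a => po_class (inl a))
    (fun m n f a => esym (po_res_class f (inl a))).

Definition po_inr : symmap B pushout :=
  @SymMap B pushout (fun n b => po_class (inr b))
    (fun m n f b => esym (po_res_class f (inr b))).

Lemma po_comm n (s : S n) : po_inl n (u n s) = po_inr n (v n s).
Proof. by apply/po_classP; apply: rst_step. Qed.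

Lemma pushout_universal (Z : symset) (a : symmap A Z) (b : symmap B Z) :
  (forall n (s : S n), a n (u n s) = b n (v n s)) ->
  exists h : symmap pushout Z,
    [/\ forall n x, h n (po_inl n x) = a n x,
        forall n x, h n (po_inr n x) = b n x
      & forall h' : symmap pushout Z,
          (forall n x, h' n (po_inl n x) = a n x) ->
          (forall n x, h' n (po_inr n x) = b n x) ->
          forall n C, h' n C = h n C].
Proof.
move=> ab.
pose ev n (x : A n + B n) := match x with inl y => a n y | inr y => b n y end.
have ev_glue n (x y : A n + B n) : glue_eqv x y -> ev n x = ev n y.
  by elim=> {x y} [_ _ [s] | x | x y _ -> | x y z _ -> _ ->] //=.
pose rep n (C : po_cell n) := projT1 (cid (po_cell_class C)).
have repK n C : C = po_class (rep n C) := projT2 (cid (po_cell_class C)).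
pose h n (C : pushout n) : Z n := ev n (rep n C).
have hE n x : h n (po_class x) = ev n x.
  by apply: ev_glue; apply/po_classP; rewrite -repK.
have h_res m n (f : fun_ m n) (C : pushout n) : h m (res f C) = res f (h n C).
  rewrite [in LHS](repK n C) /= po_res_class hE /h.
  by case: (rep n C) => x /=; rewrite app_res.
exists (SymMap h_res); split=> [n x | n x | h' ha hb n C] /=; rewrite ?hE //.
by have [[x|x] ->] := po_cell_class C; rewrite hE; [apply: ha | apply: hb].
Qed.
End Pushout.

Definition consecutive n (e : {set 'I_n.+1}) : bool :=
  [exists i : 'I_n.+1, exists j : 'I_n.+1,
    (j == i.+1 :> nat) && (e == [set i; j])].

Definition side n (e : {set 'I_n.+1}) : bool :=
  consecutive e || (e == [set ord0; ord_max]).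

Definition diagonal n (e : {set 'I_n.+1}) : bool := (#|e| == 2) && ~~ side e.

(* Diagonals of a convex polygon meet in an interior point exactly when their
   end points alternate along the boundary. *)
Definition noncrossing_diagonals n (D : {set {set 'I_n.+1}}) : bool :=
  [forall e in D, diagonal e] &&
  [forall a : 'I_n.+1, forall b : 'I_n.+1, forall c : 'I_n.+1,
   forall d : 'I_n.+1, (a < b < c) && (c < d) ==>
     ~~ (([set a; c] \in D) && ([set b; d] \in D))].

Definition triangles n (D : {set {set 'I_n.+1}}) : {set {set 'I_n.+1}} :=
  [set t : {set 'I_n.+1} | (#|t| == 3) &&
    [forall e : {set 'I_n.+1},
      (#|e| == 2) && (e \subset t) ==> side e || (e \in D)]].

(* A triangulation is cut out by a maximal set of pairwise noncrossing
   diagonals, but is recorded as its set of triangles. *)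
Record triangulation n := Triangulation {
  tri :> {set {set 'I_n.+1}};
  triP : exists2 D, maxset (@noncrossing_diagonals n) D & tri = triangles D }.

Section Carried.
Variables (n : nat).
Implicit Type F : {set {set 'I_n.+1}}.

Definition carried F m (f : representable n m) : bool :=
  [exists A in F, [forall i, f i \in A]].

Lemma carried_closed F l m (f : fun_ l m) (x : representable n m) :
  carried F x -> carried F (res f x).
Proof.
case/exists_inP=> A AF /forallP h; apply/exists_inP; exists A => //.
by apply/forallP => i; rewrite ffunE.
Qed.

Definition carried_set F : symset := sub_symset (@carried_closed F).

Definition refines F F' : Prop := forall A, A \in F -> exists2 B, B \in F' & A \subset B.

Lemma carried_refines F F' m (f : representable n m) :
  refines F F' -> carried F f -> carried F' f.
Proof.
move=> FF' /exists_inP[A /FF'[B BF' AB] /forallP h].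
by apply/exists_inP; exists B => //; apply/forallP => i; apply: (subsetP AB).
Qed.

Definition carried_incl F F' (FF' : refines F F') :
  symmap (carried_set F) (carried_set F').
Proof.
exists (fun m f => exist _ (sval f) (carried_refines FF' (svalP f))).
by move=> l m f x; apply: val_inj.
Defined.

Definition Sp : symset := carried_set [set e | consecutive e].
Definition HT (T : triangulation n) : symset := carried_set T.

(* The triangle at the side {i, i+1} has for apex the first vertex k met when
   running around the polygon from i+1 such that {i, k} is an edge of T. *)
Lemma consecutive_refines (T : triangulation n) :
  1 < n -> refines [set e | consecutive e] T.
Proof.
move=> n1 e; rewrite inE => /existsP[i /existsP[j /andP[/eqP ji /eqP ->]]].
have [D /maxsetP[ncD maxD] ->] := triP T.
have /andP[/forall_inP diagD nc] := ncD.
pose E e := side e || (e \in D).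
pose d (k : 'I_n.+1) := if i < k then k : nat else k + n.+1.
have sideS (a b : 'I_n.+1) : b = a.+1 :> nat -> E [set a; b].
  move=> ab; apply/orP; left; apply/orP; left.
  by apply/existsP; exists a; apply/existsP; exists b; rewrite ab !eqxx.
pose K := [pred k : 'I_n.+1 | [&& k != i, k != j & E [set i; k]]].
have [k0 Kk0] : exists k, K k.
  have [i0 | i0] := posnP i.
    exists ord_max; rewrite /K /= -!val_eqE /= /E /side ji i0.
    rewrite (_ : i = ord0) ?eqxx ?orbT; last exact: val_inj.
    by apply/and3P; split=> //; lia.
  have lt : i.-1 < n.+1 by have := ltn_ord i; lia.
  exists (Ordinal lt); rewrite /K /= -!val_eqE /= ji.
  by rewrite setUC sideS /=; lia.
case: (arg_minnP d Kk0) => k /and3P[ki kj Eik] kmin.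
have noE (x y : 'I_n.+1) : [set x; y] \in D -> E [set x; y].
  by rewrite /E => ->; rewrite orbT.
have Ejk : E [set j; k].
  apply: contraT => nE.
  have : noncrossing_diagonals ([set j; k] |: D).
    apply/andP; split.
      apply/forall_inP => f; rewrite !inE => /orP[/eqP -> | /diagD //].
      rewrite /diagonal cards2 (eq_sym j) kj /=.
      by apply: contra nE => h; rewrite /E h.
    apply/forallP => a; apply/forallP => b; apply/forallP => c.
    apply/forallP => x; apply/implyP => abcx.
    apply/negP => /andP[]; rewrite !in_setU1.
    have two (p q r s : 'I_n.+1) : [set p; q] = [set r; s] ->
        (p = r /\ q = s) \/ (p = s /\ q = r) \/ p = q.
      move=> eq; have: p \in [set r; s] by rewrite -eq !inE eqxx.
      have: q \in [set r; s] by rewrite -eq !inE eqxx orbT.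
      by rewrite !inE => /orP[]/eqP -> /orP[]/eqP ->; auto.
    have kmin' z : z != i -> z != j -> [set i; z] \in D -> d k <= d z.
      by move=> h1 h2 h3; apply: kmin; rewrite /K /= h1 h2 noE.
    have ncD' (p q r s : 'I_n.+1) : p < q -> q < r -> r < s ->
       [set p; r] \in D -> [set q; s] \in D -> False.
      move=> pq qr rs h1 h2; move: nc.
      move=> /forallP/(_ p)/forallP/(_ q)/forallP/(_ r)/forallP/(_ s).
      by rewrite pq qr rs h1 h2.
    have sideE (p q : 'I_n.+1) : p != q -> side [set p; q] ->
        [\/ q = p.+1 :> nat, p = q.+1 :> nat, p = 0 :> nat /\ q = n :> nat
          | q = 0 :> nat /\ p = n :> nat].
      move=> pq /orP[/existsP[r /existsP[s /andP[/eqP sr /eqP /two]]] | /eqP /two].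
        move=> [[-> ->]|[[-> ->]|/eqP]]; last by rewrite (negPf pq).
          exact: Or41.
        exact: Or42.
      by move=> [[-> ->]|[[-> ->]|/eqP]];
        [apply: Or43 | apply: Or44 | rewrite (negPf pq)].
    have {}Eik : [\/ i = k.+1 :> nat, k = 0 :> nat /\ i = n :> nat,
                    i = 0 :> nat /\ k = n :> nat | [set i; k] \in D].
      case/orP: Eik => [/sideE|]; last exact: Or44.
      rewrite eq_sym => /(_ ki)[|||] h; last 1 first.
      - exact: Or42.
      - by case/eqP: kj; apply: val_inj; rewrite /= h ji.
      - exact: Or41.
      - exact: Or43.
    have := ltn_ord x; have := ltn_ord j; rewrite /d in kmin' *.
    move: ki kj; rewrite -!val_eqE /= => /eqP ki /eqP kj jn xn.
    have kmin2 (z : 'I_n.+1) : z <> i :> nat -> z <> j :> nat -> [set i; z] \in D ->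
       (if i < k then k : nat else k + n.+1) <= (if i < z then z : nat else z + n.+1).
      by move=> /eqP h1 /eqP h2; apply: kmin'; rewrite -val_eqE.
    case/andP: abcx => /andP[ab bc] cx.
    have nval (p q : 'I_n.+1) : p = q -> p = q :> nat by move=> ->.
    have jnk : j = k -> False by move/nval => h; apply: kj.
    have eqS (A B : {set 'I_n.+1}) : A == B -> A = B by move/eqP.
    move=> /orP[/eqS acE|acD] /orP[/eqS bxE|bxD].
    - by have [[/nval + /nval]|[[/nval + /nval]|/nval]] := two _ _ _ _ (etrans acE (esym bxE)); lia.
    - case/two: acE => [[aj ck]|[[ak cj]|/nval]]; last by lia.
        subst a c; case: Eik => [||| ikD]; [lia | lia | lia |].
        by apply: (ncD' i b k x); [lia | lia | lia | |].
      subst a c; have [bi | bi] := eqVneq b i.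
        by subst b; have := kmin2 x _ _ bxD; rewrite ifF ?ifT; lia.
      have {}bi : b <> i :> nat by move/val_inj/eqP; rewrite (negPf bi).
      case: Eik => [||| ikD]; [lia | lia | lia |].
      by rewrite setUC in ikD; apply: (ncD' k b i x); [lia | lia | lia | |].
    - case/two: bxE => [[bj xk]|[[bk xj]|/nval]]; last by lia.
        subst b x; have [ai | ai] := eqVneq a i.
          by subst a; have := kmin2 c _ _ acD; rewrite !ifT; lia.
        have {}ai : a <> i :> nat by move/val_inj/eqP; rewrite (negPf ai).
        case: Eik => [||| ikD]; [lia | lia | lia |].
        by apply: (ncD' a i c k); [lia | lia | lia | |].
      subst b x; have [ci | ci] := eqVneq c i.
        subst c; rewrite setUC in acD.
        by have := kmin2 a _ _ acD; rewrite !ifF; lia.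
      have {}ci : c <> i :> nat by move/val_inj/eqP; rewrite (negPf ci).
      case: Eik => [||| ikD]; [lia | lia | lia |].
      by rewrite setUC in ikD; apply: (ncD' a k c i); [lia | lia | lia | |].
    - exact: (ncD' a b c x).
  by move/maxD => /(_ (subsetUr _ _)) eD; rewrite /E -eD !inE eqxx orbT in nE.
exists [set i; j; k]; last by rewrite subsetUl.
have ij : i != j by rewrite -val_eqE /=; lia.
rewrite inE; apply/andP; split.
  by rewrite setUC cardsU1 cards2 !inE (negPf ki) (negPf kj) ij.
apply/forallP => f; apply/implyP => /andP[/cards2P[x [y [xy ->]]]].
rewrite -/(E _) subUset !sub1set !inE -!orbA.
have Eij := sideS _ _ ji.
move=> /andP[/or3P[]/eqP hx /or3P[]/eqP hy]; move: xy; rewrite hx hy ?eqxx // => _;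
  first [by [] | by rewrite setUC].
Qed.
End Carried.

Definition Sp_incl n (hn : 1 < n) (T : triangulation n) : symmap (Sp n) (HT T) :=
  carried_incl (consecutive_refines T hn).

Definition NA n (hn : 1 < n) (T T' : triangulation n) : symset :=
  pushout (Sp_incl hn T) (Sp_incl hn T').

Definition compatible n (hn : 1 < n) (T T' : triangulation n) : Prop :=
  spiny (NA hn T T').

(* [a] and [b] play the roles of i-1 and i+1. *)
Definition cone n (T T' : triangulation n) (i k : 'I_n.+1) : Prop :=
  exists a b : 'I_n.+1,
    [/\ i = a.+1 :> nat, b = i.+1 :> nat, k \notin [set a; i; b]
      & [/\ [set a; i; k] \in tri T, [set i; b; k] \in tri T
          & [set a; i; b] \in tri T']].

Definition has_cone n (T T' : triangulation n) : Prop :=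
  (exists i k, cone T T' i k) \/ (exists i k, cone T' T i k).

Definition monotone m n (f : fun_ m n) : bool :=
  [forall i : 'I_m.+1, forall j : 'I_m.+1, (i <= j) ==> (f i <= f j)].

Definition mono m n := {f : fun_ m n | monotone f}.

Lemma monotoneP m n (f : fun_ m n) :
  reflect (forall i j : 'I_m.+1, i <= j -> f i <= f j) (monotone f).
Proof.
apply: (iffP forallP) => h i; last first.
  by apply/forallP => j; apply/implyP; apply: h.
by move=> j; have /forallP/(_ j)/implyP := h i.
Qed.

Lemma fid_monotone n : monotone (@fid n).
Proof. by apply/monotoneP => i j; rewrite !ffunE. Qed.

Lemma fcomp_monotone l m n (f : fun_ m n) (g : fun_ l m) :
  monotone f -> monotone g -> monotone (fcomp f g).
Proof.
move=> /monotoneP hf /monotoneP hg; apply/monotoneP => i j ij.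
by rewrite !ffunE; apply: hf; apply: hg.
Qed.

Definition mid {n} : mono n n := exist _ fid (fid_monotone n).
Definition mcomp {l m n} (f : mono m n) (g : mono l m) : mono l n :=
  exist _ (fcomp (sval f) (sval g)) (fcomp_monotone (svalP f) (svalP g)).

Record sset := SSet {
  scell :> nat -> Type;
  sres : forall {m n}, mono m n -> scell n -> scell m;
  sres_id : forall n (x : scell n), sres mid x = x;
  sres_comp : forall l m n (f : mono m n) (g : mono l m) (x : scell n),
    sres (mcomp f g) x = sres g (sres f x) }.

Definition underlying (X : symset) : sset :=
  @SSet X (fun m n f => res (sval f)) (@res_id X)
    (fun l m n f g x => res_comp (sval f) (sval g) x).

Section Faces.
Variable m : nat.
Implicit Types I J : {set 'I_m.+1}.

Lemma enum_sorted I : sorted ltn (map val (enum I)).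
Proof.
rewrite sorted_map {1}/enum_mem.
apply: sorted_filter; first by move=> ? ? ?; apply: ltn_trans.
by rewrite -enumT -sorted_map val_enum_ord iota_ltn_sorted.
Qed.

Lemma enum_nth_ltn I (i j : nat) : i < j -> j < #|I| ->
  nth ord0 (enum I) i < nth ord0 (enum I) j.
Proof.
move=> ij jI; have iI := ltn_trans ij jI.
have := sorted_ltn_nth ltn_trans 0 (enum_sorted I).
move=> /(_ i j); rewrite !inE size_map -cardE => /(_ iI jI ij).
by rewrite !(nth_map ord0) -?cardE.
Qed.

Lemma card_lt I (i j : 'I_(#|I|.-1).+1) : i < j -> j < #|I|.
Proof. by have := ltn_ord j; lia. Qed.

(* For nonempty I, the order preserving bijection [|I|-1] -> I followed by the
   inclusion of I into [m]. *)
Definition face_fun I : fun_ #|I|.-1 m :=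
  [ffun i : 'I_(#|I|.-1).+1 => nth ord0 (enum I) i].

Lemma face_monotone I : monotone (face_fun I).
Proof.
apply/monotoneP => i j; rewrite leq_eqVlt !ffunE => /orP[/eqP -> // | ij].
by apply/ltnW/enum_nth_ltn => //; apply: card_lt ij.
Qed.

Definition face I : mono #|I|.-1 m := exist _ (face_fun I) (face_monotone I).

(* The inclusion of I into J, under the same identifications. *)
Definition incl_fun I J : fun_ #|I|.-1 #|J|.-1 :=
  [ffun i => inord (index (face_fun I i) (enum J))].

Lemma incl_funE I J (i : 'I_(#|I|.-1).+1) : I \subset J -> i < #|I| ->
  incl_fun I J i = index (face_fun I i) (enum J) :> nat /\
  index (face_fun I i) (enum J) < #|J|.
Proof.
move=> IJ iI; have xJ : face_fun I i \in enum J.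
  rewrite mem_enum (subsetP IJ) // -mem_enum ffunE.
  by apply: mem_nth; rewrite -cardE.
have lt : index (face_fun I i) (enum J) < #|J| by rewrite (cardE J) index_mem.
by split=> //; rewrite ffunE inordK //; lia.
Qed.

Lemma face_incl_fun I J : I \subset J -> I != set0 ->
  fcomp (face_fun J) (incl_fun I J) = face_fun I.
Proof.
move=> IJ I0; apply/ffunP => i; rewrite [LHS]ffunE [LHS]ffunE.
have iI : i < #|I|.
  by have := ltn_ord i; move: I0; rewrite -card_gt0; lia.
have [-> lt] := incl_funE IJ iI.
by rewrite nth_index // -index_mem -(cardE J).
Qed.

Lemma incl_monotone I J : I \subset J -> monotone (incl_fun I J).
Proof.
move=> IJ; apply/monotoneP => i j.
rewrite leq_eqVlt => /orP[/eqP/val_inj -> // | ij].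
have jI := card_lt ij; have iI := ltn_trans ij jI.
have [-> lti] := incl_funE IJ iI; have [-> ltj] := incl_funE IJ jI.
rewrite leqNgt; apply/negP => /enum_nth_ltn /(_ lti).
rewrite !nth_index -?index_mem -?(cardE J) // !ffunE ltnNge.
by rewrite ltnW // enum_nth_ltn.
Qed.

Definition incl I J (IJ : I \subset J) : mono #|I|.-1 #|J|.-1 :=
  exist _ (incl_fun I J) (incl_monotone IJ).

Lemma face_incl I J (IJ : I \subset J) :
  I != set0 -> mcomp (face J) (incl IJ) = face I.
Proof. by move=> I0; apply: val_inj; apply: face_incl_fun. Qed.

Definition even_subset (k : nat) (J : {set 'I_m.+1}) : bool :=
  [exists P : {set {set 'I_m.+1}},
    [&& #|P| == k, partition P J & [forall A in P, consecutive A]]].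

Definition segal_index (k : nat) : Type :=
  {I : {set 'I_m.+1} |
    (I != set0) && [exists J : {set 'I_m.+1}, even_subset k J && (I \subset J)]}.
End Faces.

Section Segal.
Variables (X : sset) (k m : nat).

Definition segal_family (x : forall I : segal_index m k, X #|sval I|.-1) : Prop :=
  forall (I J : segal_index m k) (IJ : sval I \subset sval J),
    sres (incl IJ) (x J) = x I.

Definition segal_lim : Type :=
  {x : forall I : segal_index m k, X #|sval I|.-1 | segal_family x}.

Lemma segal_family_res (y : X m) :
  segal_family (fun I => sres (face (sval I)) y).
Proof.
move=> I J IJ; have /andP[I0 _] := svalP I.
by rewrite -sres_comp face_incl.
Qed.

Definition to_segal_lim (y : X m) : segal_lim :=
  exist _ (fun I => sres (face (sval I)) y) (segal_family_res y).
End Segal.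

(* [lower_segal X k] is the lower (2k-1)-Segal condition. *)
Definition lower_segal (X : sset) (k : nat) : Prop :=
  forall m, 2 * k <= m -> bijective (@to_segal_lim X k m).

(* [None] stands for infinite degree. *)
Definition deg (X : symset) : option nat :=
  if pselect (exists k, (0 < k) && `[< lower_segal (underlying X) k >]) is left h
  then Some (ex_minn h) else None.

(* Main.v *)
Require Import Defs.
From mathcomp Require Import all_boot.
From mathcomp Require Import boolp zify.

(** A cell of the pushout is a map [m] -> [n] into the vertices of the polygon
    whose image lies in a triangle, together with a color: the triangulation
    from which the triangle is taken, forgotten exactly when the map lies in the
    spine.  Compatibility says that T and T' share no ear {i-1, i, i+1}.

    Let k be 2 or 3.  In a spiny symmetric set a matching family over the even
    subsets of size 2k can be evaluated on any map into [m] whose image lies in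
    such a subset ([solves]); since any two points do, the family is a map
    f : [m] -> [n] with a color on every pair of points, and the question is
    whether this colored map is a cell ([lower_segal_of_filled]).

    It is one as soon as each triple of points is a 2-cell
    ([all_filled_cell]): four distinct values p < q < r < s would give the
    crossing diagonals pr and qs different colors, so all four sides of the
    quadrilateral would lie in triangles of both colors, hence in the spine,
    which is impossible for ps.  For k = 3 all triples lie in even
    subsets of size 6, so the pushout is always lower 5-Segal.

    For k = 2 only the triples containing two adjacent points are given.  The
    others follow if, whenever three faces uxy, uyz, uxz of a tetrahedron are
    cells, so is the fourth ([filled_tetrahedron]): take u = a + 1 to get (a, b,
    c) by induction on b - a.  When the four values are distinct, say with
    opposite values f u and f y, the diagonals uy and xz have different colors,
    the sides ux and uz have both, and the three triangles form a cone; the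
    degenerate tetrahedra only use the absence of a shared ear.  Conversely a
    cone makes the word (i-1, i, k, i, i+1) a matching family over the even
    subsets of [4]; it has four distinct values, so it is not a cell.

    Finally the word (0, 1, ..., n) is a matching family over the even subsets
    of size 2 and has at least four values, because compatible triangulations
    have n > 2; so the degree is never 1. *)

Set Implicit Arguments.
Unset Strict Implicit.
Unset Printing Implicit Defensive.

(** * Even subsets *)

Lemma even_subset_of_seq m (s : seq nat) :
  pairwise (fun p q => p.+2 <= q) s -> all (fun p => p < m) s ->
  exists2 J : {set 'I_m.+1}, even_subset (size s) J &
    forall i : 'I_m.+1, has (fun p => (i == p :> nat) || (i == p.+1 :> nat)) s ->
      i \in J.
Proof.
move=> sep ltm; set l := size s.
pose D (p : nat) : {set 'I_m.+1} := [set inord p; inord p.+1].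
have inD p (i : 'I_m.+1) : p < m ->
    (i \in D p) = (i == p :> nat) || (i == p.+1 :> nat).
  by move=> pm; rewrite !inE -!val_eqE /= !inordK //; lia.
have lts (a : 'I_l) : nth 0 s a < m by have /(all_nthP 0) := ltm; apply.
have seps (a b : 'I_l) : a < b -> (nth 0 s a).+2 <= nth 0 s b.
  by move=> ab; have /(pairwiseP 0) := sep; apply; rewrite ?inE ?ltn_ord.
pose P : {set {set 'I_m.+1}} := [set D (nth 0 s a) | a : 'I_l].
have disj (a b : 'I_l) (i : 'I_m.+1) :
    i \in D (nth 0 s a) -> i \in D (nth 0 s b) -> a = b.
  rewrite (inD _ _ (lts a)) (inD _ _ (lts b)) => ha hb; apply: val_inj.
  by have [/seps|/seps|//] := ltngtP a b; lia.
have D0 (a : 'I_l) : inord (nth 0 s a) \in D (nth 0 s a) by rewrite !inE eqxx.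
exists (cover P).
  apply/existsP; exists P; apply/and3P; split.
  - rewrite card_imset ?card_ord // => a b ab.
    by apply: (disj _ _ (inord (nth 0 s a))); rewrite -?ab D0.
  - rewrite /partition eqxx /=; apply/andP; split.
      apply/trivIsetP => A B /imsetP[a _ ->] /imsetP[b _ ->] AB.
      apply/pred0Pn => -[i /andP[/= ia ib]].
      by case/eqP: AB; rewrite (disj _ _ _ ia ib).
    by apply/imsetP => -[a _ e]; move: (D0 a); rewrite -e inE.
  - apply/forall_inP => A /imsetP[a _ ->].
    apply/existsP; exists (inord (nth 0 s a)).
    apply/existsP; exists (inord (nth 0 s a).+1).
    by have := lts a => lta; rewrite eqxx andbT !inordK; lia.
move=> i /(has_nthP 0)[a al hi]; apply/bigcupP.
exists (D (nth 0 s a)); first by apply/imsetP; exists (Ordinal al).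
by rewrite inD //; apply: (lts (Ordinal al)).
Qed.

(** Sweep the interval from the left: skip a point that need not be covered, or
    else place a domino on it.  Skipping costs room, so it stops when the rest
    can only be tiled completely; a complete tiling covers any set, whence the
    second alternative of the hypothesis, which makes the induction go through. *)
Lemma disjoint_dominoes_cover k lo hi (s : seq nat) :
  2 * k <= hi - lo -> size s <= k \/ 2 * k = hi - lo ->
  all (fun x => lo <= x < hi) s ->
  exists t : seq nat,
    [/\ size t = k, pairwise (fun p q => p.+2 <= q) t,
        all (fun p => (lo <= p) && (p.+1 < hi)) t &
        forall x, x \in s -> has (fun p => (x == p) || (x == p.+1)) t].
Proof.
move: {2}(hi - lo) (erefl (hi - lo)) => N.
elim/ltn_ind: N k lo s => N IH [|k] lo s eN kN sk ins.
  exists [::]; split=> // x xs; have := allP ins _ xs.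
  by case: sk => [|]; [case: s xs {ins} | lia].
(* Either lo is skipped, or a domino is placed at lo; in the second case lo is
   to be covered or the interval has the length of a complete tiling. *)
have [drop|tile] := boolP ((lo \notin s) && (2 * k.+1 < N)).
  have /andP[los Nk] := drop.
  have lt : hi - lo.+1 < N by lia.
  have [||||t [st pt at_ ht]] := IH _ lt k.+1 lo.+1 s.
  - by [].
  - by lia.
  - by lia.
  - apply/allP => x xs; have := allP ins _ xs.
    have : x != lo by apply: contraNneq los => <-.
    by lia.
  - by exists t; split=> //; apply/allP => p /(allP at_); lia.
have sz : lo \in s -> size [seq x <- s | lo.+2 <= x] < size s.
  move=> los; rewrite size_filter -[ltnRHS](count_predC (fun x => lo.+2 <= x)).
  rewrite -addn1 leq_add2l -has_count; apply/hasP; exists lo => //=.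
  by rewrite -ltnNge.
have lt : hi - lo.+2 < N by lia.
have [||||t [st pt at_ ht]] := IH _ lt k lo.+2 [seq x <- s | lo.+2 <= x].
- by [].
- by lia.
- by case: (boolP (lo \in s)) tile => /= [/sz|_] ?; lia.
- by rewrite all_filter; apply/allP => x /(allP ins) /=; lia.
exists (lo :: t); split=> /=; first by rewrite st.
- by rewrite pt andbT; apply/allP => p /(allP at_); lia.
- by apply/andP; split; [lia | apply/allP => p /(allP at_); lia].
- move=> x xs; have xlo := allP ins _ xs.
  have [hx|hx] := leqP lo.+2 x; first by rewrite ht ?orbT // mem_filter hx.
  by have : (x == lo) || (x == lo.+1) by [lia]; move=> /orP[] ->; rewrite ?orbT.
Qed.

Lemma even_subset_of_few m k (s : seq 'I_m.+1) :
  2 * k <= m.+1 -> size s <= k ->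
  exists2 J : {set 'I_m.+1}, even_subset k J & {subset s <= J}.
Proof.
move=> km sk.
have [|||t [st pt at_ ht]] := @disjoint_dominoes_cover k 0 m.+1 (map val s).
- by rewrite subn0.
- by rewrite size_map; left.
- by apply/allP => x /mapP[i _ ->] /=; apply: ltn_ord.
have [|J] := @even_subset_of_seq m t pt.
  by apply/allP => p /(allP at_); lia.
rewrite st => eJ inJ; exists J => // i si; apply: inJ; apply: ht.
exact: map_f.
Qed.

(** These triples are not covered by [even_subset_of_few].  One domino is
    {i, i+1} and the other one contains l; when there is no room for the latter,
    both are shifted, which is possible since m >= 4. *)
Lemma even_subset2_adjacent m (i j l : 'I_m.+1) : 4 <= m -> j = i.+1 :> nat ->
  exists2 J : {set 'I_m.+1}, even_subset 2 J & [set i; j; l] \subset J.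
Proof.
move=> m4 ji.
have [p [q [pq qm hp]]] : exists p q, [/\ p.+2 <= q, q < m &
    forall x : nat, x \in [:: i : nat; i.+1; l : nat] ->
      (x \in [:: p; p.+1]) || (x \in [:: q; q.+1])].
  have := ltn_ord l; have := ltn_ord j => jm lm.
  have [li|il] := leqP l i.-2; [|have [il3|li] := leqP i.+3 l].
  - have [i2|i2] := leqP 2 i.
      by exists l, i; split=> [||x]; rewrite ?inE; lia.
    have [i0|i0] := posnP i.
      by exists 0, 2; split=> [||x]; rewrite ?inE; lia.
    by exists 0, 2; split=> [||x]; rewrite ?inE; lia.
  - by exists i, l.-1; split=> [||x]; rewrite ?inE; lia.
  have [ilow|ihigh] := leqP i.+3 m.
    have [li1|i0] := eqVneq (l : nat) i.-1.
      by exists i.-1, i.+1; split=> [||x]; rewrite ?inE; lia.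
    by exists i, i.+2; split=> [||x]; rewrite ?inE; lia.
  have [i2|i2] := eqVneq i.+2 m.
    by exists i.-1, i.+1; split=> [||x]; rewrite ?inE; lia.
  by exists i.-2, i; split=> [||x]; rewrite ?inE; lia.
have [||J] := @even_subset_of_seq m [:: p; q].
- by rewrite /= pq.
- by rewrite /=; lia.
move=> eJ inJ; exists J => //; apply/subsetP => x; rewrite !inE => hx.
apply: inJ; rewrite /= orbF; have := hp x; rewrite !inE; apply.
by move: hx => /orP[/orP[]|] /eqP ->; rewrite ?ji eqxx ?orbT.
Qed.

Lemma consecutive_adjacent m (A : {set 'I_m.+1}) (i j : 'I_m.+1) :
  consecutive A -> i \in A -> j \in A -> i < j -> j = i.+1 :> nat.
Proof.
case/existsP=> a /existsP[b /andP[/eqP ba /eqP ->]].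
by rewrite !inE => /orP[]/eqP -> /orP[]/eqP ->; lia.
Qed.

(** Points at distance at least 2 lie in different dominoes. *)
Lemma even_subset_spread m k (J : {set 'I_m.+1}) (s : seq 'I_m.+1) :
  even_subset k J -> pairwise (fun i j : 'I_m.+1 => i.+2 <= j) s ->
  {subset s <= J} -> size s <= k.
Proof.
case/existsP=> P /and3P[/eqP <- partP /forall_inP consP] sep sJ.
have s_cover i : i \in s -> i \in cover P.
  by rewrite (cover_partition partP); apply: sJ.
pose B := pblock P.
have injB : {in s &, injective B}.
  move=> i j si sj eB; apply: val_inj.
  have iB : i \in B i by rewrite mem_pblock s_cover.
  have jB : j \in B i by rewrite eB mem_pblock s_cover.
  have cB : consecutive (B i) by apply: consP; apply: pblock_mem; apply: s_cover.
  have far (a b : 'I_m.+1) : a \in s -> b \in s -> a < b -> a.+2 <= b.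
    move=> sa sb ab; have /(pairwiseP a)/(_ (index a s) (index b s)) := sep.
    rewrite !inE !index_mem !nth_index // => /(_ sa sb).
    have [ab'|ba|eab] := ltngtP (index a s) (index b s); first by apply.
      have /(pairwiseP a)/(_ (index b s) (index a s)) := sep.
      by rewrite !inE !index_mem !nth_index // => /(_ sb sa ba); lia.
    by move: ab; rewrite -(nth_index a sa) -[in X in _ < X](nth_index a sb) eab ltnn.
  have [ij|ji|//] := ltngtP (val i) (val j).
    by have := consecutive_adjacent cB iB jB ij; have := far _ _ si sj ij; lia.
  by have := consecutive_adjacent cB jB iB ji; have := far _ _ sj si ji; lia.
have us : uniq s.
  rewrite uniq_pairwise; apply: sub_pairwise sep => i j ij.
  by apply: contraTneq ij => ->; rewrite -ltnNge.
have <- : size (map B s) = size s by rewrite size_map.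
rewrite cardE; apply: uniq_leq_size; first by rewrite map_inj_in_uniq.
by move=> A /mapP[i si ->]; rewrite mem_enum; apply: pblock_mem; apply: s_cover.
Qed.

(** * Matching families *)

Definition word l m (x : 'I_m.+1) (s : seq 'I_m.+1) : fun_ l m :=
  [ffun i : 'I_l.+1 => nth x s i].

Definition pt m (i : 'I_m.+1) : fun_ 0 m := word 0 i [:: i].
Definition pair m (i j : 'I_m.+1) : fun_ 1 m := word 1 i [:: i; j].
Definition triple m (i j l : 'I_m.+1) : fun_ 2 m := word 2 i [:: i; j; l].

Lemma fcompE l m n (f : fun_ m n) (g : fun_ l m) i : fcomp f g i = f (g i).
Proof. exact: ffunE. Qed.

Lemma fcomp_word l m n (f : fun_ m n) x s :
  size s = l.+1 -> fcomp f (word l x s) = word l (f x) (map f s).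
Proof. by move=> sl; apply/ffunP => i; rewrite !ffunE (nth_map x) ?sl. Qed.

Lemma pair0 m (i j : 'I_m.+1) : pair i j ord0 = i. Proof. by rewrite ffunE. Qed.
Lemma pair1 m (i j : 'I_m.+1) : pair i j ord_max = j. Proof. by rewrite ffunE. Qed.

Lemma fcomp_pair m n (f : fun_ m n) i j : fcomp f (pair i j) = pair (f i) (f j).
Proof. by rewrite /pair fcomp_word. Qed.

Lemma pairE m (g : fun_ 1 m) : g = pair (g ord0) (g ord_max).
Proof.
apply/ffunP => i; rewrite ffunE.
by case: i => -[|[|//]] lt /=; congr (g _); apply: val_inj.
Qed.

(** The factorization of g through the face J: a total function, which means
    something only when the image of g lies in J. *)
Definition locate l m (J : {set 'I_m.+1}) (g : fun_ l m) : fun_ l #|J|.-1 :=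
  [ffun i => inord (index (g i) (enum J))].

Lemma face_locate l m (J : {set 'I_m.+1}) (g : fun_ l m) :
  (forall i, g i \in J) -> fcomp (face_fun J) (locate J g) = g.
Proof.
move=> gJ; apply/ffunP => i; rewrite !ffunE.
have lt : index (g i) (enum J) < #|J| by rewrite cardE index_mem mem_enum.
by rewrite inordK ?nth_index ?mem_enum //; lia.
Qed.

Lemma face_fun_in m (I : {set 'I_m.+1}) i : I != set0 -> face_fun I i \in I.
Proof.
move=> I0; have ltI : i < #|I|.
  by have := ltn_ord i; move: I0; rewrite -card_gt0; lia.
by rewrite ffunE -mem_enum mem_nth // -cardE.
Qed.

Lemma locate_comp k l m (J : {set 'I_m.+1}) (g : fun_ l m) (h : fun_ k l) :
  locate J (fcomp g h) = fcomp (locate J g) h.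
Proof. by apply/ffunP => i; rewrite !ffunE. Qed.

Lemma incl_locate l m (I J : {set 'I_m.+1}) (g : fun_ l m) :
  (forall i, g i \in I) -> fcomp (incl_fun I J) (locate I g) = locate J g.
Proof.
move=> gI; have e := face_locate gI; apply/ffunP => i.
move/ffunP/(_ i): e; rewrite fcompE => e.
by rewrite fcompE [LHS]ffunE e [RHS]ffunE.
Qed.

Lemma edge_ext (X : symset) l (x y : X l) : spiny X -> 0 < l ->
  (forall g : fun_ 1 l, res g x = res g y) -> x = y.
Proof.
move=> spX l0 e; apply: (spX l l0); apply: eq_from_tnth => i.
by rewrite !tnth_mktuple.
Qed.

(** A matching family only has values on faces.  As the cells of a symmetric set
    can be restricted along arbitrary maps, it can be evaluated on every map g
    whose image lies in an index; so pairs and triples of points may be taken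
    in any order and with repetitions, and the numbering of faces disappears. *)
Section Matching.
Variables (X : symset) (k m : nat).
Implicit Type z : segal_lim (underlying X) k m.

Definition solves z l (g : fun_ l m) (x : X l) : Prop :=
  exists2 J : segal_index m k, (forall i, g i \in sval J) &
    x = res (locate (sval J) g) (sval z J).

Lemma segal_index_sub (J : segal_index m k) (I : {set 'I_m.+1}) :
  I != set0 -> I \subset sval J -> exists I' : segal_index m k, sval I' = I.
Proof.
case: J => J /= /andP[_ /exists_inP[K eK JK]] I0 IJ.
have PI : (I != set0) &&
    [exists J : {set 'I_m.+1}, even_subset k J && (I \subset J)].
  by rewrite I0; apply/exists_inP; exists K => //; apply: subset_trans JK.
by exists (exist _ I PI).
Qed.

(** The value obtained from J agrees with the one obtained from the image of g,
    which is a face of J. *)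
Lemma solves_uniq z l (g : fun_ l m) x y : solves z g x -> solves z g y -> x = y.
Proof.
have canon (x' : X l) (J I : segal_index m k) : sval I = [set g i | i : 'I_l.+1] ->
    (forall i, g i \in sval J) -> x' = res (locate (sval J) g) (sval z J) ->
    x' = res (locate (sval I) g) (sval z I).
  move=> eI gJ ->.
  have gI i : g i \in sval I by rewrite eI imset_f.
  have IJ : sval I \subset sval J.
    by apply/subsetP => j; rewrite eI => /imsetP[i _ ->].
  by rewrite -(incl_locate (sval J) gI) res_comp -(svalP z I J IJ).
case=> J gJ ex [J' gJ' ey].
have [||I eI] := @segal_index_sub J [set g i | i : 'I_l.+1].
- by apply/set0Pn; exists (g ord0); apply: imset_f.
- by apply/subsetP => j /imsetP[i _ ->].
by rewrite (canon _ _ _ eI gJ ex) (canon _ _ _ eI gJ' ey).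
Qed.

Lemma solves_res z l l' (g : fun_ l m) (h : fun_ l' l) x :
  solves z g x -> solves z (fcomp g h) (res h x).
Proof.
case=> J gJ ->; exists J; first by move=> i; rewrite fcompE.
by rewrite locate_comp res_comp.
Qed.

Lemma solves_ex z l (g : fun_ l m) J :
  even_subset k J -> (forall i, g i \in J) -> exists x, solves z g x.
Proof.
move=> eJ gJ.
have PJ : (J != set0) &&
    [exists K : {set 'I_m.+1}, even_subset k K && (J \subset K)].
  apply/andP; split; first by apply/set0Pn; exists (g ord0).
  by apply/exists_inP; exists J.
pose J' : segal_index m k := exist _ J PJ.
by exists (res (locate J g) (sval z J')); exists J'.
Qed.

Lemma solves_face z (I : segal_index m k) : solves z (face_fun (sval I)) (sval z I).
Proof.
have /andP[I0 _] := svalP I.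
have ltI (i : 'I_(#|sval I|.-1).+1) : i < #|sval I|.
  by have := ltn_ord i; move: I0; rewrite -card_gt0; lia.
exists I => [i|]; first exact: face_fun_in.
rewrite -[LHS]res_id /=; congr (res _ _); apply/ffunP => i.
rewrite [LHS]ffunE [RHS]ffunE [face_fun _ _]ffunE index_uniq ?enum_uniq -?cardE //.
by apply: val_inj; rewrite /= inordK.
Qed.

Lemma solves_to_segal_lim (y : X m) l (g : fun_ l m) x :
  solves (@to_segal_lim (underlying X) k m y) g x -> x = res g y.
Proof. by case=> J gJ ->; rewrite /= -res_comp face_locate. Qed.
End Matching.

Lemma bijective_of_inj_surj A B (f : A -> B) :
  injective f -> (forall b, exists a, f a = b) -> bijective f.
Proof.
move=> f_inj f_surj; pose g b := projT1 (cid (f_surj b)).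
have fgK b : f (g b) = b := projT2 (cid (f_surj b)).
by exists g => // a; apply: f_inj; rewrite fgK.
Qed.

(** Both injectivity and the equations for a glued cell may be tested on edges:
    any two points lie in an even subset of size 2k since k >= 2. *)
Lemma lower_segal_spiny (X : symset) k : spiny X -> 1 < k ->
  (forall m (z : segal_lim (underlying X) k m), 2 * k <= m ->
    exists y : X m, forall (g : fun_ 1 m) x, solves z g x -> res g y = x) ->
  lower_segal (underlying X) k.
Proof.
move=> spX k1 glue m km; apply: bijective_of_inj_surj => [y y' yy'|z].
  apply: edge_ext => // [|g]; first by lia.
  have [||J eJ gJ] := @even_subset_of_few m k [:: g ord0; g ord_max]; rewrite //.
    by lia.
  have [x zx] : exists x, solves (@to_segal_lim (underlying X) k m y) g x.
    apply: solves_ex eJ _ => i; apply: gJ.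
    have -> : g i = pair (g ord0) (g ord_max) i by rewrite -pairE.
    by rewrite ffunE; case: i => -[|[|//]] ? /=; rewrite !inE eqxx ?orbT.
  by rewrite -(solves_to_segal_lim zx); rewrite yy' in zx; rewrite -(solves_to_segal_lim zx).
have [y hy] := glue m z km; exists y.
(* A point is the restriction of its degenerate edge. *)
have hy' l (g : fun_ l m) x : solves z g x -> res g y = x.
  case: l g x => [|l] g x gx; last first.
    apply: edge_ext => // h; rewrite -res_comp.
    by apply: hy; apply: solves_res.
  have -> : g = fcomp (fcomp g [ffun=> ord0] : fun_ 1 m) ([ffun=> ord0] : fun_ 0 1).
    by apply/ffunP => i; rewrite !ffunE (ord1 i).
  rewrite res_comp (hy _ _ (solves_res _ gx)) -res_comp -[RHS]res_id.
  by congr (res _ _); apply/ffunP => i; rewrite !ffunE (ord1 i).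
case: z hy' {hy} => z zP hy'; apply: eq_exist.
apply: functional_extensionality_dep => I.
exact: hy' (solves_face (exist _ z zP) I).
Qed.

(** * Triangulations *)

Definition near n (u v : 'I_n.+1) : bool :=
  [|| u == v, v == u.+1 :> nat | u == v.+1 :> nat].

Lemma near_refl n (u : 'I_n.+1) : near u u.
Proof. by rewrite /near eqxx. Qed.

Lemma near_sym n (u v : 'I_n.+1) : near u v = near v u.
Proof. by rewrite /near eq_sym; congr (_ || _); rewrite orbC. Qed.

Lemma consecutive_near n (A : {set 'I_n.+1}) u v :
  consecutive A -> u \in A -> v \in A -> near u v.
Proof.
case/existsP=> a /existsP[b /andP[/eqP ba /eqP ->]].
by rewrite !inE /near => /orP[]/eqP -> /orP[]/eqP ->; rewrite ?ba ?eqxx ?orbT.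
Qed.

(** Unlike [set u; v; w] \in F, this makes sense for repeated vertices, as needed
    for degenerate cells. *)
Definition share_triangle n (F : {set {set 'I_n.+1}}) (u v w : 'I_n.+1) : Prop :=
  exists2 t, t \in F & [/\ u \in t, v \in t & w \in t].

Lemma card_triangle n (T : triangulation n) t : t \in tri T -> #|t| = 3.
Proof. by have [D _ ->] := triP T; rewrite inE => /andP[/eqP]. Qed.

Lemma set3_triangle n (T : triangulation n) u v w :
  u != v -> u != w -> v != w -> share_triangle T u v w -> [set u; v; w] \in tri T.
Proof.
move=> uv uw vw [t tT [ut vt wt]]; rewrite (_ : [set u; v; w] = t) //.
apply/eqP; rewrite eqEcard (card_triangle tT) !subUset !sub1set ut vt wt /=.
by rewrite setUC cardsU1 cards2 !inE uv (eq_sym w) (negPf uw) eq_sym (negPf vw).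
Qed.

Lemma triangles_noncrossing n (T : triangulation n) s t (a b c d : 'I_n.+1) :
  a < b -> b < c -> c < d -> s \in tri T -> t \in tri T ->
  a \in s -> c \in s -> b \in t -> d \in t -> False.
Proof.
move=> ab bc cd; have [D /maxsetP[/andP[_ nc] _] ->] := triP T.
have chord (t' : {set 'I_n.+1}) (x y : 'I_n.+1) :
    x.+1 < y -> (0 < x) || (y < n) -> t' \in triangles D ->
    x \in t' -> y \in t' -> [set x; y] \in D.
  move=> xy bd; rewrite inE => /andP[_ /forallP/(_ [set x; y])] h xt yt.
  move: h; rewrite subUset !sub1set xt yt andbT cards2 -val_eqE /=.
  rewrite (_ : val x != val y) /=; last by lia.
  case/orP => // /orP[] hs; exfalso.
    have := consecutive_near hs (set21 _ _) (set22 _ _).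
    by rewrite /near -val_eqE /=; lia.
  have /eqP e := hs.
  have x0 : (x == ord0) || (x == ord_max) by have := set21 x y; rewrite e !inE.
  have y0 : (y == ord0) || (y == ord_max) by have := set22 x y; rewrite e !inE.
  by move: x0 y0; rewrite -!val_eqE /=; have := ltn_ord x; have := ltn_ord y; lia.
have := ltn_ord d => dn.
move=> sT tT as_ cs bt dt; move: nc.
move=> /forallP/(_ a)/forallP/(_ b)/forallP/(_ c)/forallP/(_ d).
rewrite ab bc cd (chord s) ?(chord t) //; lia.
Qed.

Definition between (a c b : nat) : bool := (a < b < c) || (c < b < a).

(** a, c and b, d alternate around the polygon; this form is invariant under all
    the symmetries of a pair of crossing chords, so that no order is chosen. *)
Definition cross (a c b d : nat) : bool :=
  uniq [:: a; c; b; d] && (between a c b != between a c d).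

Lemma share_triangle_noncrossing n (T : triangulation n) (a b c d e e' : 'I_n.+1) :
  cross a c b d -> share_triangle T a c e -> share_triangle T b d e' -> False.
Proof.
move=> x [s sT [as_ cs _]] [t tT [bt dt _]].
wlog ac : a c x as_ cs / a < c.
  move=> H; have [h|h|h] := ltngtP a c; first exact: (H a c).
    by apply: (H c a) => //; move: x; rewrite /cross /between /= !inE; lia.
  by move: x; rewrite /cross /= !inE h; lia.
wlog bd : b d x bt dt / b < d.
  move=> H; have [h|h|h] := ltngtP b d; first exact: (H b d).
    by apply: (H d b) => //; move: x; rewrite /cross /between /= !inE; lia.
  by move: x; rewrite /cross /= !inE h; lia.
have [abcd|badc] : (a < b /\ b < c /\ c < d) \/ (b < a /\ a < d /\ d < c).
  by move: x; rewrite /cross /between /= !inE; lia.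
- by case: abcd => ? [? ?]; apply: (@triangles_noncrossing n T s t a b c d).
- by case: badc => ? [? ?]; apply: (@triangles_noncrossing n T t s b a d c).
Qed.

Lemma cross_of4 (a b c d : nat) : uniq [:: a; b; c; d] ->
  [\/ cross a b c d, cross a c b d | cross a d b c].
Proof.
rewrite /= !inE => h.
have [|[|]] : cross a b c d \/ cross a c b d \/ cross a d b c; last first.
- exact: Or33.
- exact: Or32.
- exact: Or31.
by rewrite /cross /between /= !inE; lia.
Qed.

Lemma share_triangle12 n F (u v w : 'I_n.+1) :
  share_triangle F u v w -> share_triangle F v u w.
Proof. by case=> t tF [ut vt wt]; exists t. Qed.

Lemma share_triangle23 n F (u v w : 'I_n.+1) :
  share_triangle F u v w -> share_triangle F u w v.
Proof. by case=> t tF [ut vt wt]; exists t. Qed.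

(** The order of x, u, z along the boundary is immaterial, the roles of x and z
    being symmetric. *)
Lemma cone_intro n (T T' : triangulation n) (x u z y : 'I_n.+1) :
  uniq [:: x; u; z; y] -> near x u -> near u z ->
  share_triangle T u x y -> share_triangle T u z y -> share_triangle T' x u z ->
  exists i k, cone T T' i k.
Proof.
move=> un xu uz uxy uzy xuz.
wlog xltz : x z un xu uz uxy uzy xuz / x < z.
  move=> H; have [h|h|/val_inj h] := ltngtP x z; first exact: (H x z).
    apply: (H z x) => //; rewrite 1?near_sym //.
      by move: un; rewrite /= !inE -!val_eqE; lia.
    by apply/share_triangle23/share_triangle12/share_triangle23.
  by move: un; rewrite h /= !inE eqxx orbT.
have := un; rewrite /= !inE -!val_eqE /= => un'.
exists u, y, x, z; split.
- by move: xu uz; rewrite /near -!val_eqE /=; lia.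
- by move: xu uz; rewrite /near -!val_eqE /=; lia.
- by rewrite !inE -!val_eqE /=; lia.
have [xu' xz' xy'] : [/\ x != u, x != z & x != y] by rewrite -!val_eqE /=; split; lia.
have [uz' uy' zy'] : [/\ u != z, u != y & z != y] by rewrite -!val_eqE /=; split; lia.
by split; apply: set3_triangle => //; apply: share_triangle12.
Qed.

(** * Colored vertex maps *)

(** The form in which compatibility is used. *)
Definition no_shared_ear n (T : bool -> triangulation n) : Prop :=
  forall u v w : 'I_n.+1, uniq [:: u; v; w] -> near u v -> near v w ->
  share_triangle (T true) u v w -> share_triangle (T false) u v w -> False.

Section Colors.
Variables (n m : nat) (T : bool -> triangulation n).
Variables (f : 'I_m.+1 -> 'I_n.+1) (col : bool -> 'I_m.+1 -> 'I_m.+1 -> Prop).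

(** Two points of [m] whose values are equal or adjacent span a spine edge, which
    has both colors; the colors are indexed by pairs of points of [m] and not by
    pairs of values, since equal values might a priori receive different colors. *)
Record coloring : Prop := Coloring {
  col_sym : forall b i j, col b i j -> col b j i;
  col_near : forall b i j, near (f i) (f j) -> col b i j;
  col_uniq : forall b c i j, ~~ near (f i) (f j) -> col b i j -> col c i j -> b = c }.

Definition filled (i j l : 'I_m.+1) : Prop :=
  exists2 b, share_triangle (T b) (f i) (f j) (f l) &
    [/\ col b i j, col b j l & col b i l].

Hypothesis colP : coloring.

Lemma filled12 i j l : filled i j l -> filled j i l.
Proof.
case=> b /share_triangle12 ? [? ? ?].
by exists b => //; split=> //; apply: (col_sym colP).
Qed.

Lemma filled23 i j l : filled i j l -> filled i l j.
Proof.
case=> b /share_triangle23 ? [? ? ?].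
by exists b => //; split=> //; apply: (col_sym colP).
Qed.

Lemma near_of_colors b c i j : b != c -> col b i j -> col c i j -> near (f i) (f j).
Proof.
move=> bc bij cij; apply: contraNT bc => far.
by rewrite (col_uniq colP far bij cij).
Qed.

(** A triple with f i = f j is a degenerate triangle, so its two long edges are
    the same edge. *)
Lemma col_congr b i j l : f i = f j -> filled i j l -> col b i l -> col b j l.
Proof.
move=> fij [c _ [_ cjl cil]] bil.
have [nr|far] := boolP (near (f j) (f l)); first exact: (col_near colP).
by rewrite -fij in far; rewrite (col_uniq colP far bil cil).
Qed.

(** Let y be the value opposite to u.  The triangles uxy and uyz share the
    diagonal uy, hence have the same color, and uxz has the other one because it
    contains the crossing diagonal xz.  So ux and uz have both colors, x, u, z are
    consecutive, and y is the apex of the cone. *)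
Lemma filled_cone u x y z : uniq [:: f u; f x; f y; f z] ->
  filled u x y -> filled u y z -> filled u x z ->
  has_cone (T true) (T false).
Proof.
wlog xs : x y z / cross (f u) (f y) (f x) (f z).
  move=> H un uxy uyz uxz.
  have /cross_of4[h|h|h] : uniq (map val [:: f u; f x; f y; f z]).
  - by rewrite (map_inj_uniq val_inj).
  - apply: (H y x z) => //; try exact: filled23.
    by move: un; rewrite /= !inE -!val_eqE /=; lia.
  - exact: (H x y z).
  - apply: (H x z y) => //; try exact: filled23.
    by move: un; rewrite /= !inE -!val_eqE /=; lia.
move=> un [b txy [bux bxy buy]] [b' tyz [b'uy b'yz b'uz]] [c txz [cux cxz cuz]].
have bb' : b = b'.
  apply: (col_uniq colP _ buy b'uy).
  by move: xs; rewrite /cross /between /near -val_eqE /= !inE; lia.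
subst b'; have bc : b != c.
  apply/eqP => bc; subst c; apply: (share_triangle_noncrossing xs).
    exact: share_triangle23 txy.
  exact: share_triangle23 (share_triangle12 txz).
have [i [k h]] : exists i k, cone (T b) (T c) i k.
  apply: (@cone_intro _ _ _ (f x) (f u) (f z) (f y)) => //.
  - by move: un; rewrite /= !inE -!val_eqE /=; lia.
  - by rewrite near_sym; apply: (near_of_colors bc).
  - exact: (near_of_colors bc).
  - exact: share_triangle23.
  - exact: share_triangle12.
by case: b c bc h {txy bux bxy buy b'uy tyz b'yz b'uz txz cux cxz cuz} => -[] // _ h;
  [left | right]; exists i, k.
Qed.

(** By symmetry the degenerate cases are f u = f x and f x = f y.  In the first
    the face uyz is already the triangle xyz.  In the second the faces uxz and
    uyz have the same values; if their colors differed, ux and uz would have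
    both colors and lie in the spine, and x, u, z would be a shared ear. *)
Lemma filled_tetrahedron u x y z : no_shared_ear T ->
  ~ has_cone (T true) (T false) ->
  filled u x y -> filled u y z -> filled u x z -> filled x y z.
Proof.
move=> ear nocone.
have ux v p q r : f v = f p -> filled v p q -> filled v p r -> filled v q r ->
    filled p q r.
  move=> e vpq vpr [b tr [bvq bqr bvr]]; exists b; first by rewrite -e.
  by split=> //; [apply: col_congr vpq bvq | apply: col_congr vpr bvr].
have xy v p q r : f p = f q -> filled v p q -> filled v p r -> filled v q r ->
    filled p q r.
  move=> e vpq vpr vqr.
  have [evp|vp] := eqVneq (f v) (f p); first exact: (ux v).
  have [evr|vr] := eqVneq (f v) (f r).
    apply/filled23/filled12; apply: (ux v) => //; exact: filled23.
  have [epr|pr] := eqVneq (f p) (f r).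
    have [b tr _] := vpr; exists b.
      by rewrite -e epr; case: tr => t ? []; exists t.
    by split; apply: (col_near colP); rewrite -?e -?epr near_refl.
  have [b tb [bvp bpr bvr]] := vpr; have [c tc [cvq cqr cvr]] := vqr.
  have [d _ [dvp dpq dvq]] := vpq.
  have [bc|bc] := eqVneq b c.
    subst c; exists b; first by rewrite -e; case: tb => t ? []; exists t.
    by split=> //; apply: (col_near colP); rewrite e near_refl.
  exfalso; have nvr := near_of_colors bc bvr cvr.
  have nvp : near (f v) (f p).
    have [db|db] := eqVneq d b; last exact: (near_of_colors db dvp bvp).
    by rewrite e; apply: (near_of_colors _ cvq dvq); rewrite db eq_sym.
  have un : uniq [:: f p; f v; f r] by rewrite /= !inE negb_or (eq_sym (f p)) vp pr vr.
  rewrite -e in tc; rewrite near_sym in nvp.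
  move/share_triangle12: tb => tb; move/share_triangle12: tc => tc.
  by case: b c bc tb tc {bvp bpr bvr cvq cqr cvr} => -[] // _ tb tc; apply: (ear _ _ _ un).
move=> uxy uyz uxz.
have [e|nux] := eqVneq (f u) (f x); first exact: (ux u).
have [e|nuy] := eqVneq (f u) (f y).
  by apply: filled12; apply: (ux u) => //; apply: filled23.
have [e|nuz] := eqVneq (f u) (f z).
  by apply/filled23/filled12; apply: (ux _ _ _ _ e) => //; exact: filled23.
have [e|nxy] := eqVneq (f x) (f y); first exact: (xy u).
have [e|nxz] := eqVneq (f x) (f z).
  by apply: filled23; apply: (xy u) => //; exact: filled23.
have [e|nyz] := eqVneq (f y) (f z).
  by apply/filled12/filled23; apply: (xy u) => //; exact: filled23.
case: nocone; apply: filled_cone uxy uyz uxz.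
by rewrite /= !inE !negb_or nux nuy nuz nxy nxz nyz.
Qed.

Hypothesis all_filled : forall i j l, filled i j l.

(** For values p < q < r < s the diagonals pr and qs cross, so the faces pqr, prs
    have one color and pqs, qrs the other.  Each of pq, qr, rs, ps is in faces of
    both colors, but p and s are too far apart to be adjacent. *)
Lemma no_four_values i j l q : ~ uniq [:: f i; f j; f l; f q].
Proof.
have main a b c d : f a < f b -> f b < f c -> f c < f d -> False.
  move=> ab bc cd.
  have [x txc [xab xbc xac]] := all_filled a b c.
  have [x' _ [x'ac x'cd x'ad]] := all_filled a c d.
  have [y tyd [yab ybd yad]] := all_filled a b d.
  have [y' _ [y'bc y'cd y'bd]] := all_filled b c d.
  have far a' b' c' : f a' < f b' -> f b' < f c' -> ~~ near (f a') (f c').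
    by move=> h1 h2; rewrite /near -val_eqE /=; lia.
  have ex := col_uniq colP (far _ _ _ ab bc) xac x'ac; subst x'.
  have ey := col_uniq colP (far _ _ _ bc cd) ybd y'bd; subst y'.
  have xy : x != y.
    apply/eqP => xy; subst y; case: txc => t ? []; case: tyd => s ? [] *.
    exact: (@triangles_noncrossing n (T x) t s _ _ _ _ ab bc cd).
  have nab := near_of_colors xy xab yab; have nbc := near_of_colors xy xbc y'bc.
  have ncd := near_of_colors xy x'cd y'cd; have nad := near_of_colors xy x'ad yad.
  by move: nab nbc ncd nad; rewrite /near -!val_eqE /=; lia.
move=> un; pose r := relpre (fun a => f a : nat) leq.
have tot : total r by move=> a b; apply: leq_total.
have := sort_sorted tot [:: i; j; l; q].
have : uniq (map f (sort r [:: i; j; l; q])).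
  by rewrite (perm_uniq (perm_map f (permEl (perm_sort r _)))).
have := size_sort r [:: i; j; l; q].
case: (sort r _) => [|a [|b [|c [|d [|]]]]] //= _.
rewrite !inE -!val_eqE /r /= => un' srt.
by apply: (main a b c d); lia.
Qed.

(** With at most three values, some triple i, j, l takes all of them, and its
    triangle and color serve for everything by [col_congr]. *)
Lemma all_filled_cell : exists b, 
  (exists2 t, t \in tri (T b) & forall i, f i \in t) /\ (forall i j, col b i j).
Proof.
have [i [j [l vals]]] : exists i j l, forall q, f q \in [:: f i; f j; f l].
  pose i : 'I_m.+1 := ord0.
  have [/forallP h|/forallPn[j fj]] := boolP [forall q, f q == f i].
    by exists i, i, i => q; rewrite inE h.
  have [/forallP h|/forallPn[l fl]] := boolP [forall q, f q \in [:: f i; f j]].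
    by exists i, j, j => q; have := h q; rewrite !inE => /orP[] ->; rewrite ?orbT.
  exists i, j, l => q; apply: contraT => fq.
  case: (@no_four_values i j l q); rewrite /= !inE !negb_or (eq_sym (f i)) fj.
  move: fl fq; rewrite !inE !negb_or !(eq_sym (f l)) !(eq_sym (f q)).
  by move=> /andP[-> ->] /and3P[-> -> ->].
have [b [t tT [it jt lt]] [ij jl il]] := all_filled i j l.
exists b; split; first by exists t => // q; have := vals q; rewrite !inE => /or3P[]/eqP ->.
have diag q q' : f q = f q' -> col b q q'.
  by move=> e; apply: (col_near colP); rewrite e near_refl.
have left_congr q q' q'' : f q = f q' -> col b q q'' -> col b q' q''.
  by move=> e; apply: col_congr.
have csym := col_sym colP.
have star q p : q \in [:: i; j; l] -> col b q p.
  move=> qs; have := vals p; rewrite !inE => /or3P[]/eqP/esym e; apply/csym;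
    apply: left_congr e _; move: qs; rewrite !inE => /or3P[]/eqP ->;
    by [apply: diag | | apply/csym].
move=> q p; have := vals q; rewrite !inE => /or3P[]/eqP/esym e;
  by apply: left_congr e _; apply: star; rewrite !inE eqxx ?orbT.
Qed.
End Colors.

(** * Cells of the glued symmetric set *)

Section Cells.
Variables (n : nat) (hn : 1 < n) (T T' : triangulation n).

Definition tri_of (b : bool) : triangulation n := if b then T else T'.

Definition sum_vertices m (x : HT T m + HT T' m) : fun_ m n :=
  match x with inl a => sval a | inr a => sval a end.

(** A relation rather than a function of the cell, because a cell of the spine
    has both colors. *)
Definition has_shape b m (f : fun_ m n) (x : NA hn T T' m) : Prop :=
  exists y, [/\ x = po_class _ _ y, b = is_inl y & f = sum_vertices y].

Let in_spine m (f : fun_ m n) : bool := carried [set e | consecutive e] f.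

(** The conclusion is an equivalence relation containing the generating one:
    gluing identifies only the two copies of a spine cell. *)
Lemma glue_eqvE m (x y : HT T m + HT T' m) :
  glue_eqv (Sp_incl hn T) (Sp_incl hn T') x y ->
  sum_vertices x = sum_vertices y /\
  (is_inl x = is_inl y \/ in_spine (sum_vertices x)).
Proof.
elim=> {x y} [_ _ [s] | x | x y _ [-> [->|h]] | x y z _ [-> h1] _ [e h2]].
- by split=> //; right; apply: svalP s.
- by split=> //; left.
- by split=> //; left.
- by split=> //; right.
- by split=> //; case: h1 => [->|]; [exact: h2 | right].
Qed.

Lemma shape_ex m (x : NA hn T T' m) : exists b f, has_shape b f x.
Proof.
have [y ->] := po_cell_class x.
by exists (is_inl y), (sum_vertices y), y.
Qed.

Lemma shape_carried b m (f : fun_ m n) x : has_shape b f x -> carried (tri_of b) f.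
Proof. by case=> -[a|a] [_ -> ->] /=; exact: (svalP a). Qed.

Lemma carried_shape b m (f : fun_ m n) : carried (tri_of b) f -> exists x, has_shape b f x.
Proof.
case: b => cf.
  pose y : HT T m + HT T' m := inl (exist _ f cf).
  by exists (po_class _ _ y), y.
pose y : HT T m + HT T' m := inr (exist _ f cf).
by exists (po_class _ _ y), y.
Qed.

Lemma shape_inj b m (f : fun_ m n) x y : has_shape b f x -> has_shape b f y -> x = y.
Proof.
case=> x' [-> -> ->] [y' [-> eb ef]]; congr (po_class _ _ _).
by case: x' y' eb ef => a [] a' //= _ /val_inj ->.
Qed.

Lemma shape_res b m l (f : fun_ m n) (g : fun_ l m) x :
  has_shape b f x -> has_shape b (fcomp f g) (res g x).
Proof.
case=> y [-> -> ->]; exists (sum_res g y).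
by split; [rewrite /= po_res_class | case: y | case: y].
Qed.

Lemma shape_vertices b c m (f g : fun_ m n) x :
  has_shape b f x -> has_shape c g x -> f = g.
Proof. by case=> y [-> _ ->] [y' [/po_classP/glue_eqvE[e _] _ ->]]. Qed.

Lemma shape_two_colors b c m (f g : fun_ m n) x :
  b != c -> has_shape b f x -> has_shape c g x -> in_spine f.
Proof.
move=> bc [y [-> eb ->]] [y' [/po_classP/glue_eqvE[_ [e|//]] ec _]].
by rewrite eb ec e eqxx in bc.
Qed.

Lemma shape_spine b c m (f : fun_ m n) x : in_spine f -> has_shape b f x -> has_shape c f x.
Proof.
move=> sf; pose s : Sp n m := exist _ f sf.
pose yl := inl (Sp_incl hn T m s) : HT T m + HT T' m.
pose yr := inr (Sp_incl hn T' m s) : HT T m + HT T' m.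
have e : po_class (Sp_incl hn T) (Sp_incl hn T') yl = po_class _ _ yr := po_comm _ _ s.
have sl : has_shape true f (po_class _ _ yl) by exists yl.
have sr : has_shape false f (po_class _ _ yl) by rewrite e; exists yr.
have both d : has_shape d f (po_class _ _ yl) by case: d.
by move=> /(shape_inj (both b)) <-.
Qed.

Lemma in_spine_near m (f : fun_ m n) i j : in_spine f -> near (f i) (f j).
Proof.
case/exists_inP=> A; rewrite inE => cA /forallP h.
exact: consecutive_near cA (h i) (h j).
Qed.

Lemma near_in_spine (f : fun_ 1 n) : near (f ord0) (f ord_max) -> in_spine f.
Proof.
have adj (u v : 'I_n.+1) : v = u.+1 :> nat -> consecutive [set u; v].
  by move=> e; apply/existsP; exists u; apply/existsP; exists v; rewrite e !eqxx.
suff H (A : {set 'I_n.+1}) : consecutive A -> f ord0 \in A -> f ord_max \in A -> in_spine f.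
  case/or3P => [/eqP e|/eqP e|/eqP e].
  - have [lt|ge] := ltnP (f ord0) n.
      pose v : 'I_n.+1 := inord (f ord0).+1.
      have ev : v = (f ord0).+1 :> nat by rewrite inordK.
      by apply: (H _ (adj _ _ ev)); rewrite -?e !inE eqxx.
    pose v : 'I_n.+1 := inord (f ord0).-1.
    have ev : f ord0 = v.+1 :> nat.
      by have fn := ltn_ord (f ord0); rewrite inordK; lia.
    by apply: (H _ (adj _ _ ev)); rewrite -?e !inE eqxx orbT.
  - by apply: (H _ (adj _ _ e)); rewrite !inE eqxx ?orbT.
  - by apply: (H _ (adj _ _ e)); rewrite !inE eqxx ?orbT.
move=> cA f0 f1; apply/exists_inP; exists A; first by rewrite inE.
apply/forallP; case=> -[|[|//]] lt.
  by rewrite (_ : Ordinal lt = ord0) //; apply: val_inj.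
by rewrite (_ : Ordinal lt = ord_max) //; apply: val_inj.
Qed.

(** A shared ear read in boundary order gives two 2-cells, one of each color,
    with the same spine edges; spininess would make them equal. *)
Lemma compatible_no_shared_ear : compatible hn T T' -> no_shared_ear tri_of.
Proof.
move=> spX u v w un uv vw uvw uvw'.
pose f : fun_ 2 n := triple u v w.
have cf b : share_triangle (tri_of b) u v w -> carried (tri_of b) f.
  case=> t tT [ut vt wt]; apply/exists_inP; exists t => //.
  by apply/forallP => -[[|[|[|//]]] lt]; rewrite ffunE.
have [x sx] := carried_shape (cf true uvw).
have [y sy] := carried_shape (cf false uvw').
have xy : x = y.
  apply: (spX 2 isT); apply: eq_from_tnth => i; rewrite !tnth_mktuple.
  apply: shape_inj (shape_res _ sx) _; apply: shape_spine (shape_res _ sy).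
  apply: near_in_spine; rewrite !fcompE !ffunE.
  by case: i => -[|[|//]] lt; rewrite /= !inordK.
subst y; have := shape_two_colors _ sx sy => /(_ isT)/exists_inP[A].
rewrite inE => /existsP[p /existsP[q /andP[_ /eqP ->]]] /forallP h.
move: (h (inord 0)) (h (inord 1)) (h (inord 2)); rewrite !ffunE !inordK //=.
move: un; rewrite /= !inE.
by case/and3P => /norP[/negPf uv' /negPf uw'] /negPf vw' _
  /orP[]/eqP eu /orP[]/eqP ev /orP[]/eqP ew; move: uv' uw' vw';
  rewrite eu ev ew eqxx.
Qed.

(** A triangle has only one triangulation, whose unique face is an ear. *)
Lemma compatible_gt2 : compatible hn T T' -> 2 < n.
Proof.
move/compatible_no_shared_ear => ear; rewrite ltn_neqAle hn andbT.
apply/eqP => n2.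
have mem (t : {set 'I_n.+1}) b i : t \in tri (tri_of b) -> i \in t.
  move=> tT; have -> : t = setT; last by rewrite inE.
  by apply/eqP; rewrite eqEcard subsetT cardsT card_ord (card_triangle tT) -n2.
have all_tri b u v w : share_triangle (tri_of b) u v w.
  have [|t tT _] := @consecutive_refines _ (tri_of b) hn [set inord 0; inord 1].
    rewrite inE; apply/existsP; exists (inord 0); apply/existsP; exists (inord 1).
    by rewrite !inordK ?eqxx //; lia.
  by exists t => //; split; apply: mem tT.
apply: (ear (inord 0) (inord 1) (inord 2)) => //.
- by rewrite /= !inE -!val_eqE /= !inordK //; lia.
- by rewrite /near !inordK ?eqxx ?orbT //; lia.
- by rewrite /near !inordK ?eqxx ?orbT //; lia.
Qed.

(** Reduces the Segal condition to combinatorics: only colored vertex maps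
    remain, with the triples contained in an even subset known to be filled. *)
Lemma lower_segal_of_filled k : compatible hn T T' -> 1 < k ->
  (forall m (f : 'I_m.+1 -> 'I_n.+1) col, 2 * k <= m -> coloring f col ->
    (forall i j l J, even_subset k J -> {subset [:: i; j; l] <= J} ->
       filled tri_of f col i j l) ->
    forall i j l, filled tri_of f col i j l) ->
  lower_segal (underlying (NA hn T T')) k.
Proof.
move=> spX k1 fill; apply: lower_segal_spiny => // m z km.
have km1 : 2 * k <= m.+1 by lia.
have point i : exists u x b, solves z (pt i) x /\ has_shape b (pt u) x.
  have [|J eJ inJ] := @even_subset_of_few m k [:: i] km1; first exact: ltnW.
  have [|x zx] := solves_ex z (l := 0) (g := pt i) eJ.
    by move=> a; rewrite ffunE (ord1 a) inJ ?inE.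
  have [b [f fx]] := shape_ex x; exists (f ord0), x, b; split=> //.
  rewrite (_ : pt _ = f) //; apply/ffunP => a.
  by rewrite ffunE (ord1 a).
have [f fP] := choice point.
pose F : fun_ m n := [ffun i => f i].
(* The vertex map of a value of the family is read off at the points of [m]. *)
have vertices l (g : fun_ l m) x b h : solves z g x -> has_shape b h x -> h = fcomp F g.
  move=> gx hx; apply/ffunP => a; rewrite fcompE ffunE.
  have [x' [b' [zx' sx']]] := fP (g a).
  have e : fcomp g (pt a) = pt (g a) by rewrite /pt fcomp_word.
  have zx := solves_res (pt a) gx; rewrite e in zx.
  have := shape_vertices (shape_res (pt a) hx); rewrite (solves_uniq zx zx').
  by move=> /(_ _ _ sx')/ffunP/(_ ord0); rewrite !ffunE.
have pairF i j : fcomp F (pair i j) = pair (f i) (f j).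
  by rewrite fcomp_pair !ffunE.
pose col b i j := exists2 x, solves z (pair i j) x & has_shape b (pair (f i) (f j)) x.
have near_spine i j : in_spine (pair (f i) (f j)) = near (f i) (f j).
  apply/idP/idP => [h|h].
    by have := in_spine_near ord0 ord_max h; rewrite pair0 pair1.
  by apply: near_in_spine; rewrite pair0 pair1.
have colP : coloring f col.
  split.
  - move=> b i j [x zx sx]; have e m' (p q : 'I_m'.+1) :
        fcomp (pair p q) (pair ord_max ord0) = pair q p.
      by rewrite fcomp_pair pair0 pair1.
    exists (res (pair ord_max ord0) x); first by rewrite -(e _ i); apply: solves_res.
    by rewrite -(e _ (f i)); apply: shape_res.
  - move=> b i j nij.
    have [|J eJ inJ] := @even_subset_of_few m k [:: i; j] km1; first exact: k1.
    have [|x zx] := solves_ex z (l := 1) (g := pair i j) eJ.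
      by move=> a; apply: inJ; rewrite ffunE; case: a => -[|[|//]] ? /=;
        rewrite !inE eqxx ?orbT.
    exists x => //; have [c [h hx]] := shape_ex x.
    have eh := vertices _ _ _ _ _ zx hx; rewrite pairF in eh; rewrite eh in hx.
    by apply: shape_spine hx; rewrite near_spine.
  - move=> b c i j far [x zx sx] [x' zx' sx']; apply: contraNeq far => bc.
    rewrite (solves_uniq zx' zx) in sx'.
    by rewrite -near_spine; apply: shape_two_colors bc sx sx'.
have filledT i j l : filled tri_of f col i j l.
  apply: (fill m f col) => // {}i {}j {}l J eJ inJ.
  have [|x zx] := solves_ex z (l := 2) (g := triple i j l) eJ.
    by move=> a; apply: inJ; rewrite ffunE; case: a => -[|[|[|//]]] ? /=;
      rewrite !inE eqxx ?orbT.
  have [b [h sx]] := shape_ex x.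
  have eh := vertices _ _ _ _ _ zx sx; rewrite eh in sx.
  have /exists_inP[t tT /forallP ht] := shape_carried sx.
  have colT a c : col b (triple i j l a) (triple i j l c).
    exists (res (pair a c : fun_ 1 2) x).
      by rewrite -fcomp_pair; apply: solves_res.
    by rewrite -pairF -fcomp_pair -fcompA; apply: shape_res.
  exists b.
    exists t => //.
    move: (ht (inord 0)) (ht (inord 1)) (ht (inord 2)).
    by rewrite !fcompE !ffunE !inordK.
  by split; [have := colT (inord 0) (inord 1) | have := colT (inord 1) (inord 2)
    | have := colT (inord 0) (inord 2)]; rewrite !ffunE !inordK.
have [b [[t tT ft] colb]] := all_filled_cell colP filledT.
have [y sy] : exists y, has_shape b F y.
  apply: carried_shape; apply/exists_inP; exists t => //.
  by apply/forallP => i; rewrite ffunE.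
exists y => g x gx; rewrite [g]pairE in gx *.
have [x' zx' sx'] := colb (g ord0) (g ord_max).
rewrite (solves_uniq gx zx'); apply: shape_inj sx'.
by rewrite -pairF; apply: shape_res.
Qed.
End Cells.

(** * Degree *)

Section Degree.
Variables (n : nat) (hn : 1 < n) (T T' : triangulation n).
Hypothesis comp : compatible hn T T'.

Let X := underlying (NA hn T T').

Lemma lower_segal3 : lower_segal X 3.
Proof.
apply: lower_segal_of_filled => // m f col m6 _ fill i j l.
have [||J eJ inJ] := @even_subset_of_few m 3 [:: i; j; l]; rewrite //.
  by lia.
exact: fill eJ inJ.
Qed.

Lemma lower_segal2 : ~ has_cone T T' -> lower_segal X 2.
Proof.
move=> nocone; apply: lower_segal_of_filled => // m f col m4 colP fill.
have ear := compatible_no_shared_ear comp.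
have f_adj (i j l : 'I_m.+1) : j = i.+1 :> nat -> filled (tri_of T T') f col i j l.
  move=> ij; have [J eJ /subsetP inJ] := even_subset2_adjacent l m4 ij.
  by apply: fill eJ _ => x; rewrite !inE => hx; apply: inJ; rewrite !inE -orbA.
have f_far d : forall i j l : 'I_m.+1, i + d = j -> filled (tri_of T T') f col i j l.
  elim: d => [|d IH] i j l ij.
    have -> : j = i by apply: val_inj; rewrite /= -ij addn0.
    have [||J eJ inJ] := @even_subset_of_few m 2 [:: i; l]; rewrite //.
      by lia.
    apply: fill eJ _ => x xs; apply: inJ; move: xs.
    by rewrite !inE => /or3P[]->; rewrite ?orbT.
  have jm := ltn_ord j.
  (* u is adjacent to i, so two of the three faces at u are known, and the third
     is closer to having adjacent points. *)
  pose u : 'I_m.+1 := inord i.+1.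
  have ui : u = i.+1 :> nat by rewrite inordK //; lia.
  apply: (filled_tetrahedron (u := u) colP ear nocone).
  - exact/filled12/f_adj.
  - by apply: IH; rewrite ui; lia.
  - exact/filled12/f_adj.
move=> i j l; have [ij|ji] := leqP i j; first by apply: (f_far (j - i)); lia.
by apply/filled12 => //; apply: (f_far (i - j)); lia.
Qed.

Lemma carried_face (F : {set {set 'I_n.+1}}) m (f : fun_ m n) (I : {set 'I_m.+1}) A :
  A \in F -> I != set0 -> (forall i, i \in I -> f i \in A) ->
  carried F (fcomp f (face_fun I)).
Proof.
move=> AF I0 fA; apply/exists_inP; exists A => //.
by apply/forallP => i; rewrite fcompE fA ?face_fun_in.
Qed.

(** The source of counterexamples.  A choice of colors for the faces f restricted
    to I is a matching family if the colors only change from J to I when the face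
    on I is in the spine; a glued cell then has vertex map f. *)
Lemma lower_segal_fill k m (f : fun_ m n) (c : {set 'I_m.+1} -> bool) :
  0 < k -> 2 * k <= m -> lower_segal X k ->
  (forall I : segal_index m k,
     carried (tri_of T T' (c (sval I))) (fcomp f (face_fun (sval I)))) ->
  (forall I J : segal_index m k, sval I \subset sval J ->
     c (sval I) != c (sval J) ->
     carried [set e | consecutive e] (fcomp f (face_fun (sval I)))) ->
  exists b, carried (tri_of T T' b) f.
Proof.
move=> k0 km seg cf csp.
pose z0 (I : segal_index m k) := projT1 (cid (carried_shape hn (cf I))).
have z0P (I : segal_index m k) :
  has_shape (c (sval I)) (fcomp f (face_fun (sval I))) (z0 I) :=
  projT2 (cid (carried_shape hn (cf I))).
have famz : @segal_family X k m z0.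
  move=> I J IJ; have /andP[I0 _] := svalP I.
  have zJ := shape_res (incl_fun (sval I) (sval J)) (z0P J).
  rewrite fcompA face_incl_fun // in zJ.
  have [e|ne] := eqVneq (c (sval I)) (c (sval J)).
    by apply: shape_inj zJ _; rewrite -e.
  apply: shape_inj zJ _; apply: shape_spine (z0P I); exact: csp IJ ne.
pose z : segal_lim X k m := exist _ z0 famz.
have [g _ gK] := seg m km.
have [b [h sy]] := shape_ex (g z); exists b.
suff -> : f = h by apply: shape_carried sy.
apply/ffunP => i.
have [||J eJ inJ] := @even_subset_of_few m k [:: i]; rewrite //; first by lia.
have iJ a : pt i a \in J by rewrite ffunE (ord1 a) inJ ?inE.
have [x zx] := solves_ex z eJ iJ.
have xy : x = res (pt i) (g z).
  by rewrite -(gK z) in zx; apply: solves_to_segal_lim zx.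
have [K iK ex] := zx.
have sx := shape_res (locate (sval K) (pt i)) (z0P K).
rewrite fcompA face_locate // -[res _ _]ex xy in sx.
have := shape_vertices sx (shape_res (pt i) sy).
by move=> /ffunP/(_ ord0); rewrite !fcompE !ffunE.
Qed.

Lemma carried_card b m (f : fun_ m n) (i j l q : 'I_m.+1) :
  carried (tri_of T T' b) f -> ~ uniq [:: f i; f j; f l; f q].
Proof.
case/exists_inP=> t tT /forallP h un.
have := uniq_leq_size un (s2 := enum t); rewrite -cardE (card_triangle tT) /=.
have sub : {subset [:: f i; f j; f l; f q] <= enum t}.
  by move=> x; rewrite mem_enum !inE => /or4P[]/eqP ->.
by move/(_ sub).
Qed.

Lemma not_lower_segal1 : ~ lower_segal X 1.
Proof.
have n2 := compatible_gt2 comp.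
move=> seg.
have spine (I : segal_index n 1) :
    carried [set e | consecutive e] (fcomp fid (face_fun (sval I))).
  case: I => I /= /andP[I0 /exists_inP[J /existsP[P /and3P[P1 partP /forall_inP cP]] IJ]].
  have [A eP] := cards1P P1.
  have JA : J = A by rewrite -(cover_partition partP) eP /cover big_set1.
  apply: (@carried_face _ _ _ _ J) => //.
    by rewrite inE JA; apply: cP; rewrite eP inE.
  by move=> i iI; rewrite ffunE (subsetP IJ).
have [||b] := lower_segal_fill (f := fid) (c := fun=> true) (isT : 0 < 1) hn seg.
- by move=> I; apply: carried_refines (spine I); apply: consecutive_refines.
- by move=> I J _; rewrite eqxx.
move=> cf; apply: (carried_card (i := inord 0) (j := inord 1) (l := inord 2)
  (q := inord 3) cf).
by rewrite /= !ffunE !inE -!val_eqE /= !inordK //; lia.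
Qed.

(** An even subset of size 4 of [4] omits 0, 2 or 4.  Omitting 4 leaves the
    values i-1, i, k, omitting 0 leaves i, i+1, k, and omitting 2 leaves
    i-1, i, i+1: the three triangles of the cone.  Faces containing 2 get the
    color b, the others the opposite one; where the color changes, the smaller
    face misses 2 and one of 0 and 4, hence is in the spine. *)
Lemma not_lower_segal2 b i k :
  cone (tri_of T T' b) (tri_of T T' (~~ b)) i k -> ~ lower_segal X 2.
Proof.
case=> p [q [ip qi kpiq [pik iqk piq]]] seg.
pose f : fun_ 4 n := word 4 i [:: p; i; k; i; q].
pose o2 : 'I_5 := inord 2.
have o2E : o2 = 2 :> nat by rewrite inordK.
have spread (I : segal_index 4 2) : o2 \in sval I ->
    (forall x, x \in sval I -> x <> 0 :> nat) \/ (forall x, x \in sval I -> x <> 4 :> nat).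
  case: I => I /= /andP[_ /exists_inP[J eJ /subsetP IJ]] I2.
  have [I0|I0] := boolP (inord 0 \in I); [right | left].
    move=> x xI x4.
    have := even_subset_spread (s := [:: inord 0; o2; x]) eJ.
    rewrite /= o2E x4 inordK // => /(_ isT); case/(_ _)/negP => // y.
    by rewrite !inE => /or3P[]/eqP ->; apply: IJ.
  move=> x xI x0; case/negP: I0; rewrite (_ : inord 0 = x) //.
  by apply: val_inj; rewrite /= x0 inordK.
have [||b'] := lower_segal_fill (f := f)
    (c := fun I => if o2 \in I then b else ~~ b) (isT : 0 < 2) (isT : 2 * 2 <= 4) seg.
- move=> I; have /andP[I0 _] := svalP I.
  case: ifP => I2.
    have [h|h] := spread I I2.
      apply: (carried_face iqk) => // -[[|[|[|[|[|//]]]]] lt] /h //= _;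
      by rewrite ffunE /= !inE eqxx ?orbT.
    apply: (carried_face pik) => // -[[|[|[|[|[|//]]]]] lt] /h //= _;
    by rewrite ffunE /= !inE eqxx ?orbT.
  apply: (carried_face piq) => // x; rewrite ffunE.
  have : x \in sval I -> x <> 2 :> nat.
    by move=> xI x2; move: I2; rewrite (_ : o2 = x) ?xI //; apply: val_inj; rewrite /= x2.
  by case: x => -[|[|[|[|[|//]]]]] lt /= h /h // _; rewrite !inE eqxx ?orbT.
- move=> I J IJ; have /andP[I0 _] := svalP I.
  case: ifP => I2; first by rewrite (subsetP IJ _ I2) eqxx.
  case: ifP => [J2 _|]; last by rewrite eqxx.
  have x2 (x : 'I_5) : x \in sval I -> x <> 2 :> nat.
    by move=> xI x2; move: I2; rewrite (_ : o2 = x) ?xI //; apply: val_inj; rewrite /= x2.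
  have cons (u v : 'I_n.+1) : v = u.+1 :> nat -> [set u; v] \in [set e | consecutive e].
    move=> e; rewrite inE; apply/existsP; exists u; apply/existsP; exists v.
    by rewrite e !eqxx.
  have [h|h] := spread J J2.
    apply: (carried_face (cons i q qi)) => // x xI.
    have := x2 x xI; have := h x (subsetP IJ _ xI); rewrite ffunE.
    by case: x {xI} => -[|[|[|[|[|//]]]]] lt //= _ _; rewrite !inE eqxx ?orbT.
  apply: (carried_face (cons p i ip)) => // x xI.
  have := x2 x xI; have := h x (subsetP IJ _ xI); rewrite ffunE.
  by case: x {xI} => -[|[|[|[|[|//]]]]] lt //= _ _; rewrite !inE eqxx ?orbT.
move=> cf; apply: (carried_card (i := inord 0) (j := inord 1) (l := inord 2)
  (q := inord 4) cf).
rewrite /= !ffunE !inordK //= !inE; move: kpiq.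
by rewrite !inE !negb_or -!val_eqE /=; lia.
Qed.
End Degree.

Lemma deg_eq (X : symset) k : 0 < k -> lower_segal (underlying X) k ->
  (forall j, 0 < j < k -> ~ lower_segal (underlying X) j) -> deg X = Some k.
Proof.
move=> k0 segk minj; rewrite /deg; case: pselect => [ex|[]]; last first.
  by exists k; rewrite k0; apply/asboolP.
case: ex_minnP => j /andP[j0 /asboolP segj] jmin.
have jk : j <= k by apply: jmin; rewrite k0; apply/asboolP.
congr Some; apply/eqP; rewrite eqn_leq jk leqNgt; apply/negP => jltk.
by apply: minj segj; rewrite j0.
Qed.

Theorem proposition18 (n : nat) (hn : 1 < n) (T T' : triangulation n)
  (hc : compatible hn T T') :
  (~ has_cone T T' -> deg (NA hn T T') = Some 2) /\
  (has_cone T T' -> deg (NA hn T T') = Some 3).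
Proof.
split=> [nocone|hascone]; apply: deg_eq => //.
- exact: lower_segal2.
- move=> j j2; have -> : j = 1 by lia.
  exact: not_lower_segal1.
- exact: lower_segal3.
move=> j j3; have [->|->] : j = 1 \/ j = 2 by lia.
  exact: not_lower_segal1.
by case: hascone => -[i [k c]];
  [apply: (@not_lower_segal2 _ _ _ _ true _ _ c)
  | apply: (@not_lower_segal2 _ _ _ _ false _ _ c)].
Qed.
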